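(* Let $q=p^k>4$, with $p$ an odd prime, and let $n\ge1$. (i) If $A\subseteq\mathbb{F}_q^n$ is strongly $e_{p-1}$-free of length $p$, then $$|A|\le p\sum_{w=0}^{n}\binom{n}{w}M_{q-1}\!\left(w,\left\lfloor\frac{(q-1)w}{p}\right\rfloor\right)\le p\,(1+\eta_{q,p})^n,\qquad 1+\eta_{q,p}<q.$$ (ii) If $A\subseteq\mathbb{F}_q^n$ contains no $p$ pairwise distinct elements annihilating $e_{p-1}$ coordinatewise, then $$|A|\le\sum_{w=0}^{n}\binom{n}{w}\sum_{r=3}^{p}r\,S(p,r)\,M_{q-1}\!\left(w,\left\lfloor\frac{(q-1)w}{r}\right\rfloor\right)\le B_p\,(1+\vartheta_q)^n,\qquad 1+\vartheta_q<q.$$ (iii) Consequently, $$\operatorname{EGZ}(p,\mathbb{F}_q^n,p-1)\le(p-1)\,B_p\,(1+\vartheta_q)^n+1.$$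
   Context: The elementary symmetric polynomial is $e_m(x_1,\dots,x_t)=\sum_{1\le i_1<\cdots<i_m\le t}x_{i_1}\cdots x_{i_m}$, applied coordinatewise to vectors of $\mathbb{F}_q^n$; here $e_{p-1}$ is taken in $p$ variables. A set $A\subseteq\mathbb{F}_q^n$ is strongly $e_m$-free of length $t$ if whenever $x^{(1)},\dots,x^{(t)}\in A$ (not necessarily distinct) satisfy $e_m(x^{(1)},\dots,x^{(t)})=0$ coordinatewise, then $x^{(1)}=\cdots=x^{(t)}$. $\operatorname{EGZ}(t,\mathbb{F}_q^n,m)$ is the least integer $\ell$ such that every sequence of length at least $\ell$ of elements of $\mathbb{F}_q^n$ (repetitions allowed) contains a subsequence of length $t$ ($t$ distinct indices) on which $e_m$ vanishes coordinatewise. For integers $Q\ge2$, $n\ge 0$, $D\ge0$, $M_Q(n,D)=|\{(a_1,\dots,a_n)\in\{0,\dots,Q-1\}^n:a_1+\cdots+a_n\le D\}|$. $S(p,r)$ denotes the Stirling number of the second kind (number of partitions of a $p$-element set into $r$ nonempty blocks), and $B_p=\sum_{r=3}^p r\,S(p,r)$. Moreover $$\vartheta_q=\inf_{0<\rho<1}(1+\rho+\cdots+\rho^{q-2})\rho^{-(q-1)/3},\qquad \eta_{q,p}=\inf_{0<\rho<1}(1+\rho+\cdots+\rho^{q-2})\rho^{-(q-1)/p}.$$ *)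

(* Defs.v *)
From HB Require Import structures.
From mathcomp Require Import all_boot all_order all_algebra.
From mathcomp Require Import all_classical all_reals all_analysis.
Set Implicit Arguments.
Unset Strict Implicit.
Unset Printing Implicit Defensive.
Import Order.TTheory GRing.Theory Num.Theory.
Local Open Scope ring_scope.

Definition esym (F : finFieldType) (t m : nat) (x : 'I_t -> F) : F :=
  \sum_(I : {set 'I_t} | #|I| == m) \prod_(i in I) x i.

Definition esym_vec (F : finFieldType) (n t m : nat) (x : 'I_t -> 'rV[F]_n) :
    'rV[F]_n :=
  \row_(j < n) esym m (fun i => x i ord0 j).

Definition strongly_esym_free (F : finFieldType) (n t m : nat)
    (A : {set 'rV[F]_n}) : Prop :=
  forall x : 'I_t -> 'rV[F]_n, (forall i, x i \in A) ->
    esym_vec m x = 0 -> forall i j, x i = x j.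

Definition distinct_esym_free (F : finFieldType) (n t m : nat)
    (A : {set 'rV[F]_n}) : Prop :=
  ~ exists x : 'I_t -> 'rV[F]_n,
      [/\ injective x, forall i, x i \in A & esym_vec m x = 0].

Definition EGZ_bound (F : finFieldType) (t n m l : nat) : Prop :=
  forall s : seq 'rV[F]_n, (l <= size s)%N ->
    exists2 f : 'I_t -> 'I_(size s), injective f &
      esym_vec m (fun i => s`_(f i)) = 0.

(* EGZ(t, F^n, m) = l. A relation rather than a function, because for
   arbitrary t and m there may be no admissible length at all. *)
Definition is_EGZ (F : finFieldType) (t n m l : nat) : Prop :=
  EGZ_bound F t n m l /\ forall l', EGZ_bound F t n m l' -> (l <= l')%N.

Definition Mcount (Q n D : nat) : nat :=
  #|[set a : {ffun 'I_n -> 'I_Q} | (\sum_(i < n) a i <= D)%N]|.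

(* finset.partition requires the blocks to be nonempty. *)
Definition stirling2 (p r : nat) : nat :=
  #|[set P : {set {set 'I_p}} | finset.partition P [set: 'I_p] & #|P| == r]|.

Definition Bsum (p : nat) : nat :=
  (\sum_(3 <= r < p.+1) r * stirling2 p r)%N.

(* The set is nonempty and bounded below by 0, so inf is a genuine infimum. *)
Definition egz_eta (R : realType) (q p : nat) : R :=
  inf [set (\sum_(i < q.-1) rho ^+ i) * rho `^ (- (q.-1%:R / p%:R))
        | rho in [set rho : R | 0 < rho < 1]]%classic.

Definition egz_theta (R : realType) (q : nat) : R := egz_eta R q 3.

(* Main.v *)
Require Import Defs.
From HB Require Import structures.
From mathcomp Require Import all_boot all_order all_algebra.
From mathcomp Require Import all_fingroup all_solvable all_field.
From mathcomp Require Import all_classical all_reals all_analysis.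
From mathcomp Require Import ring lra.
From mathcomp.boot Require Import fintype finset.
Set Implicit Arguments.
Unset Strict Implicit.
Unset Printing Implicit Defensive.
Import Order.TTheory GRing.Theory Num.Theory.
Local Open Scope ring_scope.

(** If all of [x_1, ..., x_p] are nonzero then [e_(p-1)] is their product times
    the sum of their inverses, and [e_(p-1)] vanishes when all of them are zero.
    So split a set of vectors according to their support [W], of size [w]:
    after inverting the coordinates in [W], a relation [e_(p-1) = 0] among
    vectors of support [W] follows from a zero-sum relation among vectors indexed
    by [W] with no zero coordinate, and it remains to bound families of such
    vectors with few zero-sum relations ([esym_vec_same_support],
    [card_le_sum_supports]).

    The indicator of [sum_i x_i = 0] is the product over the coordinates of
    [1 - (sum_i x_i)^(q-1)], a polynomial of degree at most [(q-1) w]. When the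
    [x_i] are made equal along a partition of the indices into [r] blocks, each
    monomial has degree at most [(q-1) w / r] in the variable of some block, and
    since the coordinates are nonzero its exponents there only matter modulo
    [q-1]. This writes the indicator, restricted to such tuples, as a sum of [r]
    times [M_(q-1)(w, (q-1) w / r)] products of a function of one block and a
    function of the others ([zero_sum_block_expansion]). A tensor of this kind
    which is diagonal with nonzero diagonal on a set [A] has at least [|A|]
    terms ([card_le_partition_rank]).

    For (i) the indicator itself is diagonal, and the partition into singletons
    gives the bound. For (ii) it need not be: a zero-sum tuple may repeat
    entries. It is multiplied by the sum, over the permutations [s] of the
    indices having at least three orbits, of [sgn s] times the indicator of
    [x o s = x]. On a zero-sum tuple which is not constant, at least three
    values occur, because [m a + (p - m) b = m (a - b)] vanishes only for
    [a = b]; so every [s] fixing it has at least three orbits, and the signs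
    cancel since some entry is repeated ([sum_sign_stabilizer]). On a constant
    tuple the value is the sum of all those signs, which is 1 modulo [p]:
    conjugation by a [p]-cycle splits the permutations in question, other than
    the identity, into classes of [p] elements with equal signs
    ([sum_sign_many_porbits]). Grouping the permutations by their orbits gives
    the Stirling numbers.

    (iii) follows by pigeonhole: a sequence either repeats a value [p] times, and
    then [e_(p-1)] vanishes because [p = 0], or has many distinct values.

    For the growth rates, [M_Q(w, D) rho^D <= (1 + ... + rho^(Q-1))^w] gives the
    upper bounds. Since [eta_(q,p) <= theta_q], the strict inequalities reduce to
    the second one, which holds because the logarithmic derivative at [rho = 1] of
    the function minimised in [theta_q] is [(q-2)/2 - (q-1)/3], positive exactly
    for [q > 4]. *)

(** * Partition rank of a diagonal tensor *)

(** The conditions cut out a space of dimension at least [|A| - |S|]. A space of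
    dimension [r] has [r] coordinates on which it restricts isomorphically, so
    it contains a vector equal to 1 on all of them. *)
Lemma orthogonal_large_support (K : fieldType) (T X : finType) (S : {set T})
    (A : {set X}) (F : T -> X -> K) :
  exists h : X -> K,
    (forall t, t \in S -> \sum_(a in A) h a * F t a = 0) /\
    (#|A| <= #|[set a in A | h a != 0%R]| + #|S|)%N.
Proof.
have [->|[a0 a0A]] := set_0Vmem A.
  by exists (fun=> 0); split=> [t _|]; rewrite ?big_set0 // cards0.
pose M : 'M[K]_(#|A|, #|S|) := \matrix_(i, j) F (enum_val j) (enum_val i).
pose N := row_base (kermx M).
have fullN : row_full N^T by rewrite /row_full mxrank_tr -/(row_free N) row_base_free.
pose f := fullrankfun fullN.
pose V := rowsub f N^T.
have Vunit : V \in unitmx by exact: fullrowsub_unit.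
pose v := (invmx V *m const_mx 1 : 'cV[K]__)^T.
pose u := v *m N.
have uf i : u ord0 (f i) = 1.
  have -> : u ord0 (f i) = (V *m v^T) i ord0.
    rewrite !mxE; apply: eq_bigr => j _.
    by rewrite !mxE mulrC.
  by rewrite trmxK mulKVmx // mxE.
have uM : u *m M = 0.
  apply: sub_kermxP; rewrite (submx_trans (submxMl _ _)) //.
  by rewrite eq_row_base.
clearbody u; exists (fun a => u ord0 (enum_rank_in a0A a)); split=> [t tS|].
  have /matrixP/(_ ord0 (enum_rank_in tS t)) := uM.
  rewrite !mxE => uM0; rewrite -[RHS]uM0 big_enum_val.
  by apply: eq_bigr => i _; rewrite mxE enum_valK_in enum_rankK_in.
have rk : (#|A| <= \rank (kermx M) + #|S|)%N.
  by rewrite mxrank_ker addnC -leq_subLR leq_sub2l // rank_leq_col.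
apply: leq_trans rk _; rewrite leq_add2r -[X in (X <= _)%N]card_ord.
have inj : injective (fun i => enum_val (f i) : X).
  by move=> i j /enum_val_inj; exact: fullrankfun_inj.
rewrite -(card_codom inj); apply: subset_leq_card; apply/subsetP => _ /codomP[i ->].
by rewrite inE enum_valP enum_valK_in uf oner_eq0.
Qed.

Definition depends_only_on (I X Y : Type) (mem : I -> bool) (f : (I -> X) -> Y) :=
  forall x y : I -> X, (forall i, mem i -> x i = y i) -> f x = f y.

Definition set_coord (I : eqType) (X : Type) (d : I) (a : X) (x : I -> X) :=
  fun i => if i == d then a else x i.

(** The slice rank argument of Tao, for partition rank as in Naslund. Induction
    on the number of coordinates in [D]. Pick [d] in [D] and contract that
    coordinate against a function [h] on [A] orthogonal to every factor that
    depends on [d] alone. The terms with such a factor disappear; a factor of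
    any other term still involves a coordinate besides [d], so the term stays
    admissible for [D :\ d]. The tensor stays diagonal, with [c] replaced by
    [h * c], so [A] shrinks to the support of [h], and it loses no more elements
    than there are terms lost. With one coordinate left no term is admissible,
    so [A] is empty. Working relative to [D] keeps the index type fixed. *)
Lemma card_le_partition_rank (K : fieldType) (I T X : finType) (D : {set I})
    (S : {set T}) (A : {set X}) (c : X -> K) (L : T -> {set I})
    (f g : T -> (I -> X) -> K) :
    D != finset.set0 -> {in A, forall a, c a != 0} ->
    {in S, forall t, [/\ L t != finset.set0, L t \proper D,
       depends_only_on [in L t] (f t) &
       depends_only_on [in D :\: L t] (g t)]} ->
    (forall x, (forall i, x i \in A) ->
      (forall d, d \in D -> (forall i, i \in D -> x i = x d) ->
         \sum_(t in S) f t x * g t x = c (x d)) /\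
      (\sum_(t in S) f t x * g t x != 0 -> {in D &, forall i j, x i = x j})) ->
  (#|A| <= #|S|)%N.
Proof.
have [m leDm] := ubnP #|D|.
elim: m => // m IH in D leDm S A c L f g *.
move=> D0 cA Sok diag.
have [->|[a0 a0A]] := set_0Vmem A; first by rewrite cards0.
have [d dD] := set0Pn _ D0.
have DE : D = d |: (D :\ d) by rewrite setD1K.
have [D'0|D'N0] := eqVneq (D :\ d) finset.set0.
  (* one coordinate left: no proper nonempty set of coordinates remains *)
  have SE : S = finset.set0.
    apply/eqP/set0Pn => -[t /Sok[L0 LD _ _]].
    have /set0Pn[i iL] := L0.
    have : i \in D by move/proper_sub/subsetP: LD; apply.
    rewrite DE D'0 finset.setU0 inE => /eqP iE.
    move: LD; rewrite DE D'0 finset.setU0 properE => /andP[_ /negP[]].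
    by rewrite sub1set -iE.
  have [/(_ d dD) dg _] := diag (fun=> a0) (fun=> a0A).
  by have := cA _ a0A; rewrite -(dg (fun _ _ => erefl)) SE big_set0 eqxx.
pose x0 := fun _ : I => a0.
pose sing t := L t == [set d].
pose cosing t := D :\: L t == [set d].
pose S1 := [set t in S | sing t || cosing t].
pose Fd t a := if sing t then f t (set_coord d a x0) else g t (set_coord d a x0).
(* For [t] in [S1], [Fd t] is the factor of [t] that depends on [d] alone, as a
   function of that coordinate; [x0] fills in the others. *)
have [h [hS1 hcard]] := orthogonal_large_support S1 A Fd.
pose A' := [set a in A | h a != 0].
have A'A a : a \in A' -> a \in A by rewrite inE => /andP[].
suff le' : (#|A'| <= #|S :\: S1|)%N.
  apply: leq_trans hcard _.
  have S1S : S1 \subset S by apply/subsetP => t; rewrite inE => /andP[].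
  rewrite (leq_trans (leq_add le' (leqnn _))) // cardsD (setIidPr S1S) subnK //.
  exact: subset_leq_card.
(* Only the factor of a term that sees [d] is averaged: the other one is
   constant along [d], so the product of the two is averaged as well. *)
pose avg (F : (I -> X) -> K) x := \sum_(a in A) h a * F (set_coord d a x).
pose f' t := if d \in L t then avg (f t) else f t.
pose g' t := if d \in L t then g t else avg (g t).
have indep (B : {set I}) (F : (I -> X) -> K) : depends_only_on [in B] F -> d \notin B ->
    forall x a, F (set_coord d a x) = F x.
  move=> dF dB x a; apply: dF => i iB; rewrite /set_coord.
  by case: eqP => // ie; rewrite -ie iB in dB.
have avg_dep (B : {set I}) F : depends_only_on [in B] F ->
    depends_only_on [in B :\ d] (avg F).
  move=> dF x y xy; apply: eq_bigr => a _; congr (_ * _); apply: dF => i iB.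
  by rewrite /set_coord; case: eqP => // /eqP id'; apply: xy; rewrite !inE id'.
have avgM t x : t \in S -> f' t x * g' t x =
    \sum_(a in A) h a * (f t (set_coord d a x) * g t (set_coord d a x)).
  move=> tS; have [_ _ df dg] := Sok _ tS.
  rewrite /f' /g'; case: ifPn => dL.
    rewrite mulr_suml; apply: eq_bigr => a _.
    by rewrite (indep _ _ dg) ?mulrA // !inE dL.
  rewrite mulr_sumr; apply: eq_bigr => a _.
  by rewrite (indep _ _ df) // mulrCA.
have kill t x : t \in S1 ->
    \sum_(a in A) h a * (f t (set_coord d a x) * g t (set_coord d a x)) = 0.
  move=> tS1; have := hS1 t tS1; rewrite inE in tS1; case/andP: tS1 => tS sc.
  have [_ _ df dg] := Sok _ tS.
  rewrite /Fd; case: (boolP (sing t)) => [/eqP Ld Fd0|Nsing Fd0].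
    rewrite -[RHS](mul0r (g t x)) -[X in _ = X * _]Fd0 mulr_suml.
    apply: eq_bigr => a _; rewrite mulrA (indep _ _ dg) ?Ld ?inE ?eqxx //.
    congr (_ * _ * _); apply: df => i; rewrite Ld inE => /eqP ->.
    by rewrite /set_coord eqxx.
  move: sc; rewrite (negPf Nsing) /= => /eqP Ld.
  have dL : d \notin L t.
    have : d \in D :\: L t by rewrite Ld set11.
    by rewrite inE => /andP[].
  rewrite -[RHS](mulr0 (f t x)) -[X in _ = _ * X]Fd0 mulr_sumr.
  apply: eq_bigr => a _; rewrite mulrCA (indep _ _ df) //.
  congr (_ * (_ * _)); apply: dg => i; rewrite Ld inE => /eqP ->.
  by rewrite /set_coord eqxx.
have sumE x : \sum_(t in S :\: S1) f' t x * g' t x =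
    \sum_(a in A) h a * \sum_(t in S) f t (set_coord d a x) * g t (set_coord d a x).
  transitivity (\sum_(t in S :\: S1) \sum_(a in A)
      h a * (f t (set_coord d a x) * g t (set_coord d a x))).
    by apply: eq_bigr => t /setDP[tS _]; exact: avgM.
  under [RHS]eq_bigr do rewrite mulr_sumr.
  rewrite [RHS]exchange_big /= [RHS](bigID [in S1]) /= [X in X + _]big1 ?add0r.
    by apply: eq_bigl => t; rewrite !inE andbC.
  by move=> t /andP[_]; exact: kill.
have A'0 : forall x, (forall i, x i \in A') -> forall a, a \in A ->
    forall i, set_coord d a x i \in A.
  by move=> x xA a aA i; rewrite /set_coord; case: ifP => // _; exact: A'A.
apply: (IH (D :\ d) _ (S :\: S1) A' (fun a => h a * c a)
          (fun t => L t :\ d) f' g') => //.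
- by move: leDm; rewrite (cardsD1 d D) dD.
- by move=> a; rewrite inE => /andP[aA ha]; rewrite mulf_neq0 // cA.
- move=> t /setDP[tS]; rewrite inE tS /= negb_or => /andP[Nsing Ncosing].
  have [L0 LD df dg] := Sok _ tS; split.
  + apply: contra Nsing; rewrite -subset0 subDset finset.setU0 subset1.
    by rewrite (negPf L0) orbF.
  + rewrite properE setSD ?(proper_sub LD) //.
    apply: contra Ncosing => sub.
    have [_ [i iD iL]] := properP LD.
    have iE : i = d.
      apply/eqP; apply/negPn/negP => id'.
      have : i \in D :\ d by rewrite !inE id'.
      by move/(subsetP sub); rewrite !inE (negPf iL) andbF.
    apply/eqP/setP => j; rewrite !inE; apply/andP/eqP => [[jL jD]|->]; last first.
      by rewrite -iE.
    apply/eqP; apply/negPn/negP => jd.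
    have : j \in D :\ d by rewrite !inE jd.
    by move/(subsetP sub); rewrite !inE (negPf jL) andbF.
  + rewrite /f'; case: ifPn => dL; first exact: avg_dep.
    by move=> x y xy; apply: df => i iL; apply: xy; rewrite !inE iL andbT;
       apply: contraNneq dL => <-.
  + rewrite /g'; case: ifPn => dL.
      move=> x y xy; apply: dg => i; rewrite inE => /andP[iL iD].
      apply: xy; rewrite !inE iD andbT.
      have id' : i != d by apply: contraNneq iL => ->.
      by rewrite id' /= (negPf iL) .
    have -> : (D :\ d) :\: (L t :\ d) = (D :\: L t) :\ d.
      by apply/setP => i; rewrite !inE; case: (i == d); rewrite ?andbF.
    exact: avg_dep.
move=> x xA'; split.
  move=> e eD' xconst; rewrite sumE.
  have xeA : x e \in A by exact: A'A.
  have [ed eD] : e != d /\ e \in D by move: eD'; rewrite !inE => /andP[].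
  rewrite (bigD1 (x e)) //= [X in _ + X]big1 ?addr0.
    congr (_ * _).
    have [+ _] := diag (set_coord d (x e) x) (A'0 _ xA' _ xeA).
    have dE : set_coord d (x e) x d = x e by rewrite /set_coord eqxx.
    move/(_ d dD); rewrite dE; apply=> i iD.
    rewrite /set_coord; have [//|id'] := eqVneq i d.
    by rewrite ?if_same xconst // !inE id'.
  move=> a /andP[aA ane].
  have [_ off] := diag (set_coord d a x) (A'0 _ xA' _ aA).
  have [->|/off/(_ d e dD eD)] := eqVneq (\sum_(t in S)
      f t (set_coord d a x) * g t (set_coord d a x)) 0; first by rewrite mulr0.
  by rewrite /set_coord eqxx (negPf ed) => ae; rewrite ae eqxx in ane.
rewrite sumE => nz.
have [a aA hne] : exists2 a, a \in A &
   \sum_(t in S) f t (set_coord d a x) * g t (set_coord d a x) != 0.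
  apply/exists_inP; apply: contraNT nz => /exists_inPn ne.
  by rewrite big1 // => a /ne /negPn/eqP ->; rewrite mulr0.
have [_ /(_ hne) off] := diag (set_coord d a x) (A'0 _ xA' _ aA).
move=> i j; rewrite !inE => /andP[id' iD] /andP[jd jD].
by have := off i j iD jD; rewrite /set_coord (negPf id') (negPf jd).
Qed.

(** * Expansion of the zero-sum indicator along a partition *)

Definition zero_sum (F : nzRingType) (I J : finType) (y : I -> J -> F) :=
  [forall j, \sum_i y i j == 0].

Lemma finfield_expf_pred (F : finFieldType) (x : F) :
  x ^+ #|F|.-1 = (x != 0)%:R.
Proof.
have F1 := finNzRing_gt1 F.
have [->|x0] := eqVneq x 0.
  by rewrite expr0n; case: #|F| F1 => [|[]].
apply: (mulfI x0); rewrite -exprS prednK ?mulr1 ?expf_card //.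
by apply: leq_trans F1.
Qed.

Lemma prod_ffunE (F : comNzRingType) (I : finType) (N : nat) (f : {ffun 'I_N -> I})
    (y : I -> F) :
  \prod_k y (f k) = \prod_i y i ^+ #|[set k | f k == i]|.
Proof.
rewrite (partition_big f xpredT) //=; apply: eq_bigr => i _.
rewrite -prodr_const; apply: eq_big => [k|k /eqP -> //].
by rewrite inE.
Qed.

(** Only the degree bound matters: it says that the coefficients and exponents
    come from a polynomial of degree at most [q - 1] in the variables [y i j]
    with the same [j], namely the product over [j] of [1 - (sum_i y i j)^(q-1)]. *)
Lemma zero_sum_monomials (F : finFieldType) (I J : finType) :
  exists (Phi : finType) (c : Phi -> F) (m : Phi -> I -> J -> nat),
    (forall t j, \sum_i m t i j <= #|F|.-1)%N /\
    forall y : I -> J -> F,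
      (zero_sum y)%:R = \sum_t c t * \prod_i \prod_j y i j ^+ m t i j.
Proof.
pose Q := #|F|.-1.
(* A monomial of [1 - (sum_i y i j)^Q]: the constant 1, or a choice of a
   summand in each of the [Q] factors. *)
pose Mon := (unit + {ffun 'I_Q -> I})%type.
pose c1 (o : Mon) : F := if o is inl _ then 1 else -1.
pose m1 (o : Mon) i := if o is inr f then #|[set k | f k == i]| else 0%N.
exists {ffun J -> Mon}, (fun t : {ffun J -> Mon} => \prod_j c1 (t j)),
  (fun (t : {ffun J -> Mon}) i j => m1 (t j) i).
split=> [t j|y].
  case: (t j) => [_|f] /=; first by rewrite big1.
  rewrite (eq_bigr (fun i => \sum_(k | f k == i) 1)%N); last first.
    by move=> i _; rewrite sum1dep_card.
  rewrite (exchange_big_dep xpredT) //=.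
  rewrite (eq_bigr (fun=> 1%N)) ?sum1_card ?card_ord // => k _.
  by rewrite (big_pred1 (f k)) // => i; rewrite eq_sym.
transitivity (\prod_j (1 - (\sum_i y i j) ^+ Q)).
  rewrite /zero_sum; case: forallP => [z|/forallP].
    by rewrite big1 // => j _; rewrite finfield_expf_pred z subr0.
  rewrite negb_forall => /existsP[j nz].
  by rewrite (bigD1 j) //= finfield_expf_pred nz subrr mul0r.
transitivity (\prod_j \sum_(o : Mon) c1 o * \prod_i y i j ^+ m1 o i).
  apply: eq_bigr => j _; rewrite big_sumType /= big_const card_unit /= addr0.
  rewrite [X in 1 * X]big1 // mulr1; congr (_ + _).
  rewrite -[in LHS](card_ord Q) -prodr_const bigA_distr_bigA -sumrN.
  by apply: eq_bigr => f _; rewrite mulN1r (prod_ffunE f (fun i => y i j)).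
rewrite bigA_distr_bigA; apply: eq_bigr => t _.
by rewrite big_split /= exchange_big.
Qed.

Definition block_const (I : finType) (X : eqType) (B : {set I}) (x : I -> X) :=
  [forall i in B, forall j in B, x i == x j].

Lemma block_constP (I : finType) (X : eqType) (B : {set I}) (x : I -> X) :
  reflect {in B &, forall i j, x i = x j} (block_const B x).
Proof.
apply: (iffP forall_inP) => [h i j iB jB|h i iB].
  by have /forall_inP/(_ j jB)/eqP := h i iB.
by apply/forall_inP => j jB; rewrite (h i j).
Qed.

Definition compatible (I : finType) (X : eqType) (P : {set {set I}}) (x : I -> X) :=
  [forall B in P, block_const B x].

(** The restriction to tuples constant on [B] of a monomial in the coordinates
    of the common value; any index of [B] represents it. *)
Definition block_monomial (F : nzRingType) (I J X : finType) (Q : nat)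
    (y : X -> J -> F) (B : {set I}) (a : {ffun J -> 'I_Q}) (x : I -> X) : F :=
  if [pick i in B] is Some i then
    (block_const B x)%:R * \prod_j y (x i) j ^+ a j
  else 0.

Definition exponents (J : finType) (Q D : nat) : {set {ffun J -> 'I_Q}} :=
  [set a : {ffun J -> 'I_Q} | (\sum_j a j <= D)%N].

Lemma block_const_ext (I : finType) (X : eqType) (B : {set I}) (x z : I -> X) :
  {in B, x =1 z} -> block_const B x = block_const B z.
Proof.
move=> xz; apply/block_constP/block_constP => h i j iB jB.
  by rewrite -(xz i) // -(xz j) // (h i j).
by rewrite (xz i) // (xz j) // (h i j).
Qed.

(** The degree [(q-1) |J|] of a monomial is shared among the [|P|] blocks, so
    some block [B] gets at most [(q-1) |J| / |P|] of it. Attach the monomial to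
    that block. On tuples constant on [B] its part in [B] is a monomial in one
    vector, whose exponents can be reduced modulo [q - 1] because the
    coordinates are nonzero; [G B a] collects the cofactors of the monomials
    attached to [B] with reduced exponents [a]. *)
Lemma zero_sum_block_expansion (F : finFieldType) (I J X : finType)
    (y : X -> J -> F) (A : {set X}) (P : {set {set I}}) :
    {in A, forall a j, y a j != 0} -> finset.partition P [set: I] -> P != finset.set0 ->
  exists G : {set I} -> {ffun J -> 'I_#|F|.-1} -> (I -> X) -> F,
    {in P, forall B a, depends_only_on [in ~: B] (G B a)} /\
    forall x, (forall i, x i \in A) ->
      (compatible P x)%:R * (zero_sum (fun i => y (x i)))%:R =
      \sum_(B in P) \sum_(a in exponents J #|F|.-1 ((#|F|.-1 * #|J|) %/ #|P|))
        block_monomial y B a x * G B a x.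
Proof.
move=> yA /and3P[/eqP covP tP P0] Pn0.
pose Q := #|F|.-1.
have Q0 : (0 < Q)%N.
  by rewrite -ltnS prednK ?finNzRing_gt1 // (leq_trans _ (finNzRing_gt1 F)).
have r0 : (0 < #|P|)%N by rewrite card_gt0.
have [Phi [c [m [mQ expand]]]] := zero_sum_monomials F I J.
pose deg t (B : {set I}) := (\sum_(i in B) \sum_j m t i j)%N.
have low t : exists2 B, B \in P & (deg t B * #|P| <= Q * #|J|)%N.
  apply/exists_inP; rewrite -[X in is_true X]negbK negb_exists_in.
  apply/negP => /forall_inP high.
  have : (\sum_(B in P) (Q * #|J|).+1 <= \sum_(B in P) deg t B * #|P|)%N.
    by apply: leq_sum => B /high; rewrite -ltnNge.
  rewrite sum_nat_const -big_distrl /= mulnC leq_pmul2r // /deg -big_trivIset //= covP.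
  rewrite leqNgt ltnS => /negP[].
  rewrite (eq_bigl xpredT) => [|i]; last by rewrite inE.
  rewrite exchange_big /= mulnC -sum_nat_const.
  by apply: leq_sum => j _; exact: mQ.
(* [beta t] is the block to which the monomial [t] is attached. *)
pose beta t := odflt finset.set0 [pick B in P | (deg t B * #|P| <= Q * #|J|)%N].
have betaP t : beta t \in P /\ (deg t (beta t) * #|P| <= Q * #|J|)%N.
  rewrite /beta; case: pickP => [B /andP[]//|none].
  by have [B BP dB] := low t; have := none B; rewrite BP dB.
pose alpha t : {ffun J -> 'I_Q} :=
  [ffun j => Ordinal (ltn_pmod (\sum_(i in beta t) m t i j) Q0)].
have alphaP t : alpha t \in exponents J Q ((Q * #|J|) %/ #|P|).
  rewrite inE leq_divRL //; apply: leq_trans (betaP t).2.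
  rewrite leq_pmul2r // /deg exchange_big /=; apply: leq_sum => j _.
  by rewrite ffunE /= leq_mod.
exists (fun B a x => (compatible (P :\ B) x)%:R *
   \sum_(t | (beta t == B) && (alpha t == a)) c t *
      \prod_(i in ~: B) \prod_j y (x i) j ^+ m t i j); split.
  move=> B BP a x z xz.
  have -> : compatible (P :\ B) x = compatible (P :\ B) z.
    apply: eq_forallb_in => C; rewrite !inE => /andP[CB CP].
    apply: block_const_ext => i iC; apply: xz; rewrite inE.
    by rewrite (disjointFr (trivIsetP tP C B CP BP CB)).
  congr (_ * _); apply: eq_bigr => t _; congr (_ * _).
  by apply: eq_bigr => i iB; rewrite xz.
move=> x xA; rewrite expand mulr_sumr pair_big_dep /=.
rewrite (partition_big (fun t => (beta t, alpha t))
  (fun Ba => (Ba.1 \in P) &&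
     (Ba.2 \in exponents J Q ((Q * #|J|) %/ #|P|)))) /=; last first.
  by move=> t _; rewrite (betaP t).1 alphaP.
apply: eq_bigr => -[B a] /= /andP[BP _].
rewrite mulrCA !mulr_sumr; apply: eq_big => [t|t /eqP[bE aE]].
  by rewrite xpair_eqE.
have splitP : compatible P x = block_const B x && compatible (P :\ B) x.
  apply/forall_inP/andP => [h|[cB /forall_inP h] C CP].
    by split; [exact: h | apply/forall_inP => C /setD1P[_]; exact: h].
  by have [->//|CB] := eqVneq C B; apply: h; rewrite !inE CB.
rewrite splitP -mulnb natrM /block_monomial.
have [i0 i0B|B0] := pickP; last first.
  by move: P0; rewrite -(_ : B = finset.set0) ?BP //; apply/setP => i; rewrite B0 inE.
case: (boolP (block_const B x)) => [/block_constP cB|_]; last by rewrite !mul0r mulr0.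
rewrite !mul1r -[RHS]mulrCA mulrCA; congr (_ * _); rewrite mulrCA; congr (_ * _).
rewrite (bigID [in B]) /=; congr (_ * _); last first.
  by apply: eq_bigl => i; rewrite inE.
rewrite exchange_big /=; apply: eq_bigr => j _.
rewrite -aE ffunE bE /= expr_mod; last first.
  by rewrite finfield_expf_pred yA ?xA.
by rewrite -prodrXr; apply: eq_bigr => i iB; rewrite (cB i i0).
Qed.

Lemma block_monomial_dep (F : nzRingType) (I J X : finType) (Q : nat)
    (y : X -> J -> F) (B : {set I}) (a : {ffun J -> 'I_Q}) :
  depends_only_on [in B] (block_monomial y B a).
Proof.
move=> x z xz; rewrite /block_monomial; case: pickP => // i iB.
by rewrite (block_const_ext xz) (xz i).
Qed.

Lemma partition_block_proper (I : finType) (P : {set {set I}}) (B : {set I}) :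
  finset.partition P [set: I] -> (1 < #|P|)%N -> B \in P -> B \proper [set: I].
Proof.
move=> partP P1 BP; have /and3P[_ tP P0] := partP.
rewrite properT; apply/eqP => BT.
have : (#|P :\ B| != 0)%N by move: P1; rewrite (cardsD1 B) BP add1n ltnS lt0n.
rewrite cards_eq0 => /set0Pn[C /setD1P[CB CP]].
have := disjoint_setI0 (trivIsetP tP C B CP BP CB).
by rewrite BT setIT => C0; rewrite -C0 CP in P0.
Qed.

(** The tensor to which the partition rank bound is applied is the zero-sum
    indicator times the sum of [kappa P] over the partitions [P] along which the
    tuple is constant. The hypotheses say that it is diagonal, with the constant
    diagonal value [\sum_(P in Pi) kappa P]. *)
Lemma card_le_sum_partitions (F : finFieldType) (I J X : finType)
    (y : X -> J -> F) (A : {set X}) (Pi : {set {set {set I}}})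
    (kappa : {set {set I}} -> F) :
    (0 < #|I|)%N ->
    {in A, forall a j, y a j != 0} ->
    {in Pi, forall P, finset.partition P [set: I] /\ (1 < #|P|)%N} ->
    (forall x : I -> X, (forall i, x i \in A) -> zero_sum (fun i => y (x i)) ->
      \sum_(P in Pi | compatible P x) kappa P != 0 -> forall i j, x i = x j) ->
    (forall a, a \in A -> zero_sum (fun _ : I => y a)) ->
    (\sum_(P in Pi) kappa P != 0) ->
  (#|A| <= \sum_(P in Pi) #|P| *
     #|exponents J #|F|.-1 ((#|F|.-1 * #|J|) %/ #|P|)|)%N.
Proof.
move=> I0 yA PiP off const_zero diag.
pose Q := #|F|.-1.
pose expo (P : {set {set I}}) := exponents J Q ((Q * #|J|) %/ #|P|).
pose T := ({set {set I}} * {set I} * {ffun J -> 'I_Q})%type.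
pose S := [set t : T | [&& t.1.1 \in Pi, t.1.2 \in t.1.1 & t.2 \in expo t.1.1]].
have S_sum (V : nmodType) (phi : {set {set I}} -> {set I} -> {ffun J -> 'I_Q} -> V) :
    \sum_(P in Pi) \sum_(B in P) \sum_(a in expo P) phi P B a =
    \sum_(t in S) phi t.1.1 t.1.2 t.2.
  rewrite (eq_bigr (fun P : {set {set I}} =>
      \sum_(q : {set I} * {ffun J -> 'I_Q} | (q.1 \in P) && (q.2 \in expo P))
      phi P q.1 q.2)); last by move=> P _; rewrite pair_big_dep.
  rewrite pair_big_dep /=.
  rewrite (reindex (fun t : T => (t.1.1, (t.1.2, t.2)))) /=; last first.
    exists (fun t => (t.1, t.2.1, t.2.2)) => [[[P B] a]|[P [B a]]] //.
  by apply: eq_bigl => t; rewrite [RHS]in_set.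
have /choice[G GP] : forall P, exists G : {set I} -> {ffun J -> 'I_Q} -> (I -> X) -> F,
    P \in Pi ->
    {in P, forall B a, depends_only_on [in ~: B] (G B a)} /\
    forall x, (forall i, x i \in A) ->
      (compatible P x)%:R * (zero_sum (fun i => y (x i)))%:R =
      \sum_(B in P) \sum_(a in expo P) block_monomial y B a x * G B a x.
  move=> P; have [PPi|_] := boolP (P \in Pi); last by exists (fun _ _ _ => 0).
  have [partP P1] := PiP P PPi.
  have P0 : P != set0 by rewrite -card_gt0 (ltnW P1).
  by have [G hG] := zero_sum_block_expansion yA partP P0; exists G.
have <- : #|S| = (\sum_(P in Pi) #|P| * #|expo P|)%N.
  rewrite -sum1_card -(S_sum nat (fun _ _ _ => 1%N)).
  by apply: eq_bigr => P _; rewrite sum_nat_const sum1_card.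
have tensorE x : (forall i, x i \in A) ->
    \sum_(t in S) (kappa t.1.1 * block_monomial y t.1.2 t.2 x) * G t.1.1 t.1.2 t.2 x
    = (zero_sum (fun i => y (x i)))%:R * \sum_(P in Pi | compatible P x) kappa P.
  move=> xA; rewrite -(S_sum F (fun P B a =>
    kappa P * block_monomial y B a x * G P B a x)).
  rewrite mulr_sumr [RHS]big_mkcondr /=; apply: eq_bigr => P PPi.
  have [_ /(_ x xA) expand] := GP P PPi.
  rewrite (_ : (if _ then _ else _) = kappa P *
     ((compatible P x)%:R * (zero_sum (fun i => y (x i)))%:R)); last first.
    by case: ifP; rewrite ?mul1r ?mul0r ?mulr0 // mulrC.
  rewrite expand mulr_sumr; apply: eq_bigr => B _.
  by rewrite mulr_sumr; apply: eq_bigr => a _; rewrite mulrA.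
apply: (@card_le_partition_rank F I T X setT S A (fun=> \sum_(P in Pi) kappa P)
  (fun t => t.1.2) (fun t x => kappa t.1.1 * block_monomial y t.1.2 t.2 x)
  (fun t => G t.1.1 t.1.2 t.2)).
- by rewrite -card_gt0 cardsT.
- by [].
- move=> [[P B] a]; rewrite inE /= => /and3P[PPi BP _].
  have [partP P1] := PiP P PPi; split.
  + by have /and3P[_ _] := partP; apply: contraNneq => <-.
  + exact: partition_block_proper partP P1 BP.
  + by move=> x z xz; rewrite (block_monomial_dep _ _ xz).
  + by rewrite setTD; have [/(_ B BP a)] := GP P PPi.
move=> x xA; rewrite tensorE //; split=> [d _ xd|nz i j _ _].
  have xE : (fun i => y (x i)) = (fun=> y (x d)).
    by apply: funext => i; rewrite xd.
  rewrite xE const_zero // mul1r; apply: eq_bigl => P.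
  rewrite andb_idr // => _; apply/forall_inP => B _; apply/block_constP => i j _ _.
  by rewrite (xd i) ?(xd j).
apply: off => //; first by apply: contraNT nz => /negPf->; rewrite mul0r.
by apply: contraNneq nz => ->; rewrite mulr0.
Qed.

(** * Signs of permutations with many orbits *)

Lemma porbitJ (T : finType) (s t : {perm T}) (x : T) :
  porbit (s ^ t)%g (t x) = t @: porbit s x.
Proof.
apply/setP => z; apply/porbitP/imsetP => [[i ->]|[_ /porbitP[i ->] ->]].
  by exists ((s ^+ i)%g x); rewrite ?mem_porbit // -conjXg permJ.
by exists i; rewrite -conjXg permJ.
Qed.

Lemma card_porbitsJ (T : finType) (s t : {perm T}) :
  #|porbits (s ^ t)%g| = #|porbits s|.
Proof.
rewrite -[RHS](card_imset _ (imset_inj (@perm_inj _ t))); congr #|pred_of_set _|.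
apply/setP => B; apply/imsetP/imsetP => [[x _ ->]|[_ /imsetP[x _ ->] ->]].
  exists (porbit s (t^-1 x)%g); first exact: imset_f.
  by rewrite -porbitJ permKV.
by exists (t x); rewrite ?inE // porbitJ.
Qed.

Lemma card_porbits1 (T : finType) : #|porbits (1%g : {perm T})| = #|T|.
Proof.
have porbit1 x : porbit (1%g : {perm T}) x = [set x].
  apply/setP => z; rewrite inE; apply/porbitP/eqP => [[i ->]|->].
    by rewrite expg1n perm1.
  by exists 0%N; rewrite expg0 perm1.
rewrite /porbits card_imset // => x z.
by rewrite !porbit1 => /set1_inj.
Qed.

Definition rotation (p : nat) : {perm 'I_p} := perm (@ordS_inj p).

Lemma rotationXE (p m : nat) (i : 'I_p) :
  ((rotation p ^+ m)%g i = (i + m) %% p :> nat)%N.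
Proof.
elim: m => [|m IH]; first by rewrite expg0 perm1 addn0 modn_small.
by rewrite expgSr permM permE /= IH -addn1 modnDml addn1 addnS.
Qed.

Lemma rotation_expp (p : nat) : (rotation p ^+ p)%g = 1%g.
Proof.
apply/permP => i; apply: val_inj; rewrite /= rotationXE perm1.
by rewrite modnDr modn_small.
Qed.

(** A permutation commuting with a regular cycle is a power of it, and for [p]
    prime a nontrivial power generates the same group. *)
Lemma commute_rotation (p : nat) (s : {perm 'I_p}) : prime p ->
  commute s (rotation p) -> s != 1%g -> #|porbits s| = 1%N.
Proof.
move=> p_pr comm s1; pose c := rotation p.
have p0 := prime_gt0 p_pr; pose o : 'I_p := Ordinal p0.
have transc i : i = (c ^+ (i : 'I_p))%g o.
  by apply: val_inj; rewrite /= rotationXE add0n modn_small.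
have sE : s = (c ^+ s o)%g.
  apply/permP => i; rewrite {1}(transc i) -permM.
  have -> : (c ^+ i * s = s * c ^+ i)%g by apply/ssrfun.esym/commuteX.
  by rewrite permM {1}(transc (s o)) -permM -expgD addnC expgD permM -transc.
have s_c : s \in <[c]>%g by rewrite sE mem_cycle.
have oc : (#[c]%g %| p)%N by rewrite order_dvdn rotation_expp.
have os : #[s]%g = p.
  have : (#[s]%g %| p)%N by apply: dvdn_trans oc; exact: order_dvdG.
  case/primeP: p_pr => _ p_div /p_div /orP[|/eqP//].
  by rewrite order_eq1 (negPf s1).
have c_s : c \in <[s]>%g.
  have -> : <[s]>%g = <[c]>%g; last exact: cycle_id.
  by apply/eqP; rewrite eqEcard cycle_subG s_c -!/(order _) os dvdn_leq.
apply/eqP/cards1P; exists (porbit s o); apply/setP => B; rewrite inE.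
apply/imsetP/eqP => [[i _ ->]|->]; last by exists o.
apply/eqP; rewrite eq_porbit_mem (transc i).
have /cycleP[m cE] := c_s.
by rewrite cE -expgM mem_porbit.
Qed.

(** Conjugation by the rotation preserves both the sign and the number of
    orbits, so modulo [p] only the permutations commuting with it count. Those
    other than the identity have one orbit, hence are excluded by [1 < m]. *)
Lemma sum_sign_many_porbits (K : nzRingType) (p m : nat) :
    prime p -> p \in [pchar K] -> (1 < m <= p)%N ->
  \sum_(s : {perm 'I_p} | (m <= #|porbits s|)%N) (-1) ^+ s = 1 :> K.
Proof.
move=> p_pr pcharK /andP[m1 mp]; pose c := rotation p.
pose S (b : bool) := [set s : {perm 'I_p} | (m <= #|porbits s|)%N & odd_perm s == b].
have pG : (p.-group <[c]>)%g.
  apply: pnat_dvd (pnat_id p_pr); rewrite -/(order c).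
  by rewrite order_dvdn rotation_expp.
have cardS b : (#|S b| = ~~ b %[mod p])%N.
  have act : [acts <[c]>, on S b | conjg_action _]%g.
    apply/actsP => a _ s; rewrite !inE /= card_porbitsJ odd_permJ //.
  rewrite (pgroup_fix_mod pG act) afixJ cent_cycle.
  congr (_ %% _)%N; rewrite (_ : _ :&: _ = if b then set0 else [set 1%g]); last first.
    apply/setP => s; rewrite in_setI in_set -andbA; apply/and3P/idP => [[ms sb sc]|].
      have [s1|s1] := eqVneq s 1%g.
        by move: sb; rewrite s1 odd_perm1; case: (b) => // _; exact: set11.
      have /commute_rotation/(_ s1) ps : commute s (rotation p) by exact/cent1P.
      by rewrite ps // leqNgt m1 in ms.
    case: b {act} => [|/set1P ->]; first by rewrite in_set0.
    by split; rewrite ?card_porbits1 ?card_ord ?odd_perm1 ?group1.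
  by case: b {act}; rewrite ?cards0 ?cards1.
have SE b : \sum_(s in S b) (-1) ^+ s = (-1) ^+ b *+ #|S b| :> K.
  by rewrite -sumr_const; apply: eq_bigr => s; rewrite inE => /andP[_ /eqP ->].
rewrite (bigID (fun s : {perm 'I_p} => odd_perm s)) /=.
have -> : \sum_(s : {perm 'I_p} | (m <= #|porbits s|)%N && odd_perm s) (-1) ^+ s = 0 :> K.
  transitivity (\sum_(s in S true) (-1) ^+ s : K).
    by apply: eq_bigl => s; rewrite in_set eqb_id.
  rewrite SE -mulr_natr -(GRing.natr_mod_pchar pcharK) cardS.
  by rewrite GRing.natr_mod_pchar //= mulr0.
rewrite add0r; transitivity (\sum_(s in S false) (-1) ^+ s : K).
  by apply: eq_bigl => s; rewrite in_set eqbF_neg.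
rewrite SE -mulr_natr -(GRing.natr_mod_pchar pcharK) cardS.
by rewrite GRing.natr_mod_pchar //= mulr1.
Qed.

(** Multiplying by the transposition of two indices with the same value is a
    sign-reversing involution of the stabilizer. *)
Lemma sum_sign_stabilizer (K : nzRingType) (T : finType) (X : eqType) (x : T -> X) :
    ~ injective x ->
  \sum_(s : {perm T} | [forall i, x (s i) == x i]) (-1) ^+ s = 0 :> K.
Proof.
move=> /injectiveP/injectivePn[i [j ij xij]].
pose t := tperm i j.
have xt k : x (t k) = x k.
  by rewrite /t; case: tpermP => [->|->|].
rewrite (bigID (fun s : {perm T} => odd_perm s)) /=.
rewrite (reindex_inj (mulgI t)) /=.
apply/eqP; rewrite addr_eq0 -sumrN; apply/eqP; apply: eq_big => s.
  rewrite odd_mul_tperm ij /=; congr andb.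
  apply/forallP/forallP => h k.
    by have := h (t k); rewrite permM xt tpermK.
  by rewrite permM -[X in _ == X]xt.
by rewrite odd_mul_tperm ij /= => /andP[_ /negPf ->]; rewrite expr0 expr1.
Qed.

(** * Zero-sum free families of nowhere zero vectors *)

Lemma porbits_partition (T : finType) (s : {perm T}) :
  finset.partition (porbits s) [set: T].
Proof.
apply/and3P; split.
- rewrite eqEsubset subsetT; apply/subsetP => x _.
  by apply/bigcupP; exists (porbit s x); rewrite ?imset_f ?porbit_id.
- apply/trivIsetP => _ _ /imsetP[x _ ->] /imsetP[z _ ->].
  apply: contraR => /pred0Pn[t /andP[/= tx tz]].
  rewrite -eq_porbit_mem in tx; rewrite -eq_porbit_mem in tz.
  by rewrite -(eqP tx) (eqP tz).
- by apply/imsetP => -[x _ E]; have := porbit_id s x; rewrite -E in_set0.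
Qed.

Lemma compatible_porbits (T : finType) (X : eqType) (s : {perm T}) (x : T -> X) :
  compatible (porbits s) x = [forall i, x (s i) == x i].
Proof.
apply/forall_inP/forallP => [h i|h B /imsetP[j _ ->]].
  have /block_constP c := h (porbit s i) (imset_f _ isT).
  by apply/eqP/c; rewrite ?porbit_id // -{1}[s]expg1 mem_porbit.
have xs m k : x ((s ^+ m)%g k) = x k.
  by elim: m => [|m IH]; rewrite ?expg0 ?perm1 // expgSr permM (eqP (h _)).
by apply/block_constP => _ _ /porbitP[a ->] /porbitP[b ->]; rewrite !xs.
Qed.

(** The tuple factors through the set of orbits. *)
Lemma card_image_le_porbits (T X : finType) (s : {perm T}) (x : T -> X) :
  (forall i, x (s i) = x i) -> (#|x @: [set: T]| <= #|porbits s|)%N.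
Proof.
move=> inv; have [i0 _|T0] := pickP (predT : pred T); last first.
  rewrite (_ : x @: _ = set0) ?cards0 //; apply/setP => a; rewrite inE.
  by apply/imsetP => -[i _ _]; have := T0 i.
have cst : compatible (porbits s) x.
  by rewrite compatible_porbits; apply/forallP => i; rewrite inv.
pose rep (B : {set T}) := x (odflt i0 [pick i in B]).
apply: leq_trans (leq_imset_card rep (mem (porbits s))).
apply/subset_leq_card/subsetP => _ /imsetP[i _ ->].
apply/imsetP; exists (porbit s i); first exact: imset_f.
rewrite /rep; case: pickP => [j js|/(_ i)]; last by rewrite porbit_id.
have /forall_inP/(_ _ (imset_f _ (isT : i \in T)))/block_constP := cst.
by apply; rewrite ?porbit_id.
Qed.

Lemma zero_sum_const (F : finFieldType) (p : nat) (J : finType) (y : J -> F) :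
  p \in [pchar F] -> zero_sum (fun _ : 'I_p => y).
Proof.
move=> pF; apply/forallP => j.
by rewrite sumr_const card_ord mulrn_pchar.
Qed.

(** The zero-sum indicator is itself diagonal, so the partition into singletons
    suffices; it is written as the set of orbits of the identity. *)
Lemma card_le_zero_sum_const (F : finFieldType) (p : nat) (J X : finType)
    (y : X -> J -> F) (A : {set X}) :
    prime p -> p \in [pchar F] -> {in A, forall a j, y a j != 0} ->
    (forall x : 'I_p -> X, (forall i, x i \in A) -> zero_sum (fun i => y (x i)) ->
       forall i j, x i = x j) ->
  (#|A| <= p * #|exponents J #|F|.-1 ((#|F|.-1 * #|J|) %/ p)|)%N.
Proof.
move=> p_pr pF yA hA; pose D := porbits (1%g : {perm 'I_p}).
have cardD : #|D| = p by rewrite card_porbits1 card_ord.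
have := @card_le_sum_partitions F 'I_p J X y A [set D] (fun=> 1).
rewrite !big_set1 cardD oner_eq0; apply=> //.
- by rewrite card_ord prime_gt0.
- by move=> P /set1P ->; rewrite cardD prime_gt1 // porbits_partition.
- by move=> x xA zx _; apply: hA.
- by move=> a _; apply: zero_sum_const.
Qed.

(** If [a] is taken [m] times and [b] the other [p - m] times, the sum is
    [m (a - b)], and [m] is invertible modulo [p]. *)
Lemma two_values_zero_sum (F : finFieldType) (p : nat) (J X : finType)
    (y : X -> J -> F) (x : 'I_p -> X) (i j : 'I_p) :
    p \in [pchar F] -> zero_sum (fun i => y (x i)) -> x i != x j ->
    (forall k, (x k == x i) || (x k == x j)) ->
  y (x i) =1 y (x j).
Proof.
move=> pF /forallP zx ij two k; have p_pr := pcharf_prime pF.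
pose C := [set l | x l == x i].
have Clt : (0 < #|C| < p)%N.
  apply/andP; split; first by rewrite card_gt0; apply/set0Pn; exists i; rewrite inE.
  rewrite -[X in (_ < X)%N]card_ord -cardsT; apply: proper_card.
  rewrite properT; apply: contra ij => /eqP CT.
  by have : j \in C by [rewrite CT inE]; rewrite inE eq_sym.
have := eqP (zx k); rewrite (bigID [in C]) /=.
rewrite (eq_bigr (fun=> y (x i) k)); last by move=> l; rewrite inE => /eqP ->.
rewrite [X in _ + X](eq_bigr (fun=> y (x j) k)); last first.
  by move=> l; rewrite inE => li; have := two l; rewrite (negPf li) => /eqP ->.
rewrite !sumr_const.
have -> : #|[predC C]| = (p - #|C|)%N.
  apply/eqP; rewrite -(eqn_add2l #|C|) cardC card_ord subnKC // ltnW //.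
  by case/andP: Clt.
rewrite mulrnBr ?(mulrn_pchar pF) ?sub0r; last by case/andP: Clt => _ /ltnW.
move=> /eqP; rewrite -mulrnBl -mulr_natr mulf_eq0 -(dvdn_pcharf pF).
by rewrite gtnNdvd ?orbF; case/andP: Clt => // _ _; rewrite subr_eq0 => /eqP.
Qed.

Definition partitions_from (p m : nat) : {set {set {set 'I_p}}} :=
  [set P : {set {set 'I_p}} | finset.partition P [set: 'I_p] & (m <= #|P|)%N].

(** The weight of [P] is the signed number of permutations whose orbits are the
    blocks of [P]. Summed over all [P], these weights would cancel on every
    zero-sum tuple, as none is injective; the permutations with one or two
    orbits fix only those zero-sum tuples that are constant, so omitting them
    changes the tensor on the diagonal alone. *)
Lemma card_le_zero_sum_distinct (F : finFieldType) (p : nat) (J X : finType)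
    (y : X -> J -> F) (A : {set X}) :
    prime p -> odd p -> p \in [pchar F] ->
    {in A, forall a j, y a j != 0} -> {in A &, forall a b, y a =1 y b -> a = b} ->
    (forall x : 'I_p -> X, (forall i, x i \in A) -> zero_sum (fun i => y (x i)) ->
       ~ injective x) ->
  (#|A| <= \sum_(P in partitions_from p 3) #|P| *
     #|exponents J #|F|.-1 ((#|F|.-1 * #|J|) %/ #|P|)|)%N.
Proof.
move=> p_pr p_odd pF yA y_inj hA.
pose kappa (P : {set {set 'I_p}}) : F :=
  \sum_(s : {perm 'I_p} | porbits s == P) (-1) ^+ s.
have kappaE (b : pred {set {set 'I_p}}) :
    \sum_(P in partitions_from p 3 | b P) kappa P =
    \sum_(s : {perm 'I_p} | (3 <= #|porbits s|)%N && b (porbits s)) (-1) ^+ s.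
  rewrite [RHS](partition_big (fun s => porbits s)
     (fun P => (P \in partitions_from p 3) && b P)) /=; last first.
    by move=> s /andP[s3 ->]; rewrite in_set porbits_partition s3.
  apply: eq_bigr => P /andP[]; rewrite in_set => /andP[_ P3] bP.
  by apply: eq_bigl => s; case: eqP => [->|]; rewrite ?P3 ?bP ?andbF.
apply: (@card_le_sum_partitions F 'I_p J X y A (partitions_from p 3) kappa) => //.
- by rewrite card_ord prime_gt0.
- by move=> P; rewrite in_set => /andP[-> /ltnW].
- move=> x xA zx; rewrite kappaE => nz i j.
  apply/eqP/negPn/negP => ij; case/negP: nz; apply/eqP.
  rewrite -[RHS](sum_sign_stabilizer F (hA x xA zx)).
  apply: eq_bigl => s; rewrite compatible_porbits andb_idl // => /forallP inv.
  apply: leq_trans (card_image_le_porbits (fun k => eqP (inv k))).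
  rewrite ltnNge; apply/negP => im2.
  have imE : x @: [set: 'I_p] = [set x i; x j].
    apply/ssrfun.esym/eqP; rewrite eqEcard cards2 ij im2 andbT.
    by apply/subsetP => _ /set2P[] ->; exact: imset_f.
  case/eqP: (ij); apply: y_inj => //; apply: two_values_zero_sum pF zx ij _.
  move=> k; have : x k \in x @: [set: 'I_p] by exact: imset_f.
  by rewrite imE in_set2.
- by move=> a _; apply: zero_sum_const.
have -> : \sum_(P in partitions_from p 3) kappa P =
    \sum_(s : {perm 'I_p} | (3 <= #|porbits s|)%N) (-1) ^+ s.
  rewrite (eq_bigl (fun P => (P \in partitions_from p 3) && xpredT P)).
    by rewrite kappaE; apply: eq_bigl => s; rewrite andbT.
  by move=> P; rewrite andbT.
rewrite sum_sign_many_porbits ?oner_eq0 //.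
by case: p p_pr p_odd {yA pF hA kappa kappaE} => [|[|[|p]]].
Qed.

Lemma card_partition_le (T : finType) (P : {set {set T}}) (D : {set T}) :
  finset.partition P D -> (#|P| <= #|D|)%N.
Proof.
move=> partP; rewrite (card_partition partP) -sum1_card; apply: leq_sum => B BP.
rewrite card_gt0; have /and3P[_ _] := partP.
by apply: contraNneq => <-.
Qed.

Lemma sum_partitions_stirling (p m : nat) (f : nat -> nat) :
  (\sum_(P in partitions_from p m) #|P| * f #|P| =
   \sum_(m <= r < p.+1) r * stirling2 p r * f r)%N.
Proof.
have inordE P : P \in partitions_from p m -> (inord #|P| : 'I_p.+1) = #|P| :> nat.
  rewrite in_set => /andP[partP _]; rewrite inordK // ltnS.
  by have := card_partition_le partP; rewrite cardsT card_ord.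
rewrite big_geq_mkord /= [LHS](partition_big
  (fun P : {set {set 'I_p}} => inord #|P| : 'I_p.+1) (fun r => m <= r)%N) /=.
  apply: eq_bigr => r mr; rewrite mulnAC -[RHS]mulnC -sum_nat_const.
  apply: eq_big => [P|P /andP[PP /eqP Pr]]; last by rewrite -(inordE P PP) Pr.
  rewrite [RHS]in_set; apply/andP/andP => [[PP /eqP Pr]|[partP /eqP Pr]].
    by rewrite -(inordE P PP) Pr; move: PP; rewrite in_set => /andP[-> _].
  have PP : P \in partitions_from p m by rewrite in_set partP Pr.
  by split=> //; apply/eqP/val_inj; rewrite /= (inordE P PP).
by move=> P PP; rewrite (inordE P PP); move: PP; rewrite in_set => /andP[].
Qed.

(** * Counting exponent vectors: growth rates *)

Lemma Mcount_mono (Q n D E : nat) : (D <= E)%N -> (Mcount Q n D <= Mcount Q n E)%N.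
Proof.
move=> DE; apply/subset_leq_card/subsetP => a; rewrite !in_set => aD.
exact: leq_trans aD DE.
Qed.

(** The right-hand side is the generating function of all exponent vectors by
    total degree, and those counted have [rho ^+ D] as a lower bound. *)
Lemma Mcount_mul_le (R : realDomainType) (Q n D : nat) (rho : R) : 0 <= rho <= 1 ->
  (Mcount Q n D)%:R * rho ^+ D <= (\sum_(i < Q) rho ^+ i) ^+ n.
Proof.
move=> /andP[rho0 rho1].
rewrite -[in leRHS](card_ord n) -prodr_const bigA_distr_bigA /=.
rewrite (bigID [in [set a : {ffun 'I_n -> 'I_Q} | (\sum_(i < n) a i <= D)%N]]) /=.
rewrite -[X in X <= _]addr0 lerD //; last first.
  by apply: sumr_ge0 => a _; apply: prodr_ge0 => i _; exact: exprn_ge0.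
rewrite mulr_natl -sumr_const; apply: ler_sum => a; rewrite in_set => aD.
rewrite prodrXr; exact: ler_wiXn2l.
Qed.

Section GrowthRate.
Variable R : realType.
Implicit Types (rho : R) (q p n : nat).

Let rate q p rho : R := (\sum_(i < q.-1) rho ^+ i) * rho `^ (- (q.-1%:R / p%:R)).

Lemma rate_ge0 q p rho : 0 < rho -> 0 <= rate q p rho.
Proof.
move=> rho0; rewrite mulr_ge0 ?powR_ge0 // sumr_ge0 // => i _.
exact/exprn_ge0/ltW.
Qed.

Lemma Mcount_le_rate q p n rho : (0 < p)%N -> 0 < rho < 1 ->
  (Mcount q.-1 n ((q.-1 * n) %/ p))%:R <= rate q p rho ^+ n.
Proof.
move=> p0 /andP[rho0 rho1]; set D := (_ %/ p)%N.
have rhoD : 0 < rho ^+ D by exact: exprn_gt0.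
apply: le_trans (_ : (\sum_(i < q.-1) rho ^+ i) ^+ n * (rho ^+ D)^-1 <= _).
  by rewrite ler_pdivlMr // Mcount_mul_le // !ltW.
rewrite exprMn ler_wpM2l //.
  by apply/exprn_ge0/sumr_ge0 => i _; exact/exprn_ge0/ltW.
rewrite -(powR_mulrn n (powR_ge0 _ _)) -powRrM -(powR_mulrn D (ltW rho0)) -powRN.
apply: ger_powR; first by rewrite rho0 ltW.
rewrite mulNr lerN2 mulrAC ler_pdivlMr ?ltr0n //.
by rewrite -!natrM ler_nat leq_trunc_div.
Qed.

(** Taking [n]-th roots turns the hypothesis into a lower bound of [S]. *)
Lemma le_inf_expn (S : set R) (x : R) n : (S !=set0)%classic -> 0 <= x ->
  (forall y, S y -> 0 <= y /\ x <= y ^+ n) -> x <= inf S ^+ n.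
Proof.
move=> [y0 Sy0] x0 xS; case: n xS => [|n] xS.
  by have [_] := xS _ Sy0; rewrite !expr0.
pose z := x `^ n.+1%:R^-1.
have zx : z ^+ n.+1 = x.
  by rewrite -powR_mulrn ?powR_ge0 // -powRrM mulVf ?powRr1 // pnatr_eq0.
have z_inf : z <= inf S.
  apply: lb_le_inf; first by exists y0.
  move=> y /xS[y0' xy]; rewrite leNgt; apply/negP => yz.
  by move: xy; rewrite -zx leNgt ltrXn2r // ?powR_ge0.
rewrite -zx lerXn2r ?nnegrE ?powR_ge0 //.
exact: le_trans (powR_ge0 _ _) z_inf.
Qed.

Lemma rates_nonempty q p :
  ([set rate q p rho | rho in [set rho : R | 0 < rho < 1]] !=set0)%classic.
Proof. by exists (rate q p 2^-1); exists 2^-1 => //=; lra. Qed.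

Lemma egz_eta_le_rate q p rho : 0 < rho < 1 -> egz_eta R q p <= rate q p rho.
Proof.
move=> rho01; apply: ge_inf; last by exists rho.
by exists 0 => _ /= [r /andP[r0 _] <-]; exact: rate_ge0.
Qed.

Lemma egz_eta_ge0 q p : 0 <= egz_eta R q p.
Proof.
apply: lb_le_inf; first exact: rates_nonempty.
by move=> _ /= [r /andP[r0 _] <-]; exact: rate_ge0.
Qed.

Lemma Mcount_le_egz_eta q p n : (0 < p)%N ->
  (Mcount q.-1 n ((q.-1 * n) %/ p))%:R <= egz_eta R q p ^+ n.
Proof.
move=> p0; apply: le_inf_expn => //; first exact: rates_nonempty.
move=> _ /= [r r01 <-]; split; last exact: Mcount_le_rate.
by apply: rate_ge0; case/andP: r01.
Qed.

(** Since [rho < 1], the exponent [-(q-1)/p] gives smaller values than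
    [-(q-1)/3] does. *)
Lemma egz_eta_le_theta q p : (3 <= p)%N -> egz_eta R q p <= egz_theta R q.
Proof.
move=> p3; apply: lb_le_inf; first exact: rates_nonempty.
move=> _ /= [r r01 <-]; apply: le_trans (egz_eta_le_rate q p r01) _.
case/andP: r01 => r0 r1; rewrite /rate ler_wpM2l //.
  by apply: sumr_ge0 => i _; exact/exprn_ge0/ltW.
apply: ger_powR; first by rewrite r0 ltW.
rewrite lerN2 ler_wpM2l // lef_pV2 ?posrE ?ltr0n ?ler_nat //.
exact: leq_trans p3.
Qed.

(** A second-order complement to Bernoulli's inequality, crude in the quadratic
    term. *)
Lemma expr_oneB_le (e : R) n : 0 <= e <= 1 ->
  (1 - e) ^+ n <= 1 - n%:R * e + (n%:R * e) ^+ 2.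
Proof.
move=> /andP[e0 e1]; elim: n => [|n IH]; first by rewrite expr0; lra.
have n0 : 0 <= n%:R :> R by [].
rewrite exprS -natr1; apply: le_trans (ler_wpM2l _ IH) _; first lra.
have : 0 <= n%:R * e ^+ 2 by rewrite mulr_ge0 // sqr_ge0.
have : 0 <= n%:R ^+ 2 * e ^+ 3 by rewrite mulr_ge0 ?sqr_ge0 // exprn_ge0.
nra.
Qed.

Lemma expr_oneB_ge (e : R) n : 0 <= e <= 1 -> 1 - n%:R * e <= (1 - e) ^+ n.
Proof.
move=> /andP[e0 e1]; elim: n => [|n IH]; first by rewrite expr0; lra.
rewrite exprS -natr1; apply: le_trans (ler_wpM2l _ IH); last lra.
by have : 0 <= n%:R * e ^+ 2; [rewrite mulr_ge0 ?sqr_ge0 | nra].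
Qed.

Lemma geometric_sum_cube_le (e : R) n : 0 <= e <= 1 ->
  2 * \sum_(i < n) ((1 - e) ^+ 3) ^+ i <=
  2 * n%:R - 3 * e * (n%:R * (n%:R - 1)) + 18 * e ^+ 2 * n%:R ^+ 3.
Proof.
move=> e01; elim: n => [|n IH]; first by rewrite big_ord0; lra.
rewrite big_ord_recr /= mulrDr -exprM -natr1.
have := expr_oneB_le (3 * n) e01; rewrite natrM => top.
have n0 : 0 <= n%:R :> R by [].
have := mulr_ge0 (sqr_ge0 e) n0.
have := mulr_ge0 (sqr_ge0 e) (sqr_ge0 (n%:R : R)).
have := sqr_ge0 e.
nra.
Qed.

(** At [rho = 1] the function minimised has value [q - 1], and it decreases as
    [rho] moves below 1. Taking [rho = s ^+ 3] clears the fractional exponent: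
    the claim becomes [\sum_(i < Q) s ^+ (3 * i) < Q * s ^+ Q] with [Q = q - 1],
    and to first order in [e = 1 - s] it reads [3 Q (Q - 1) / 2 > Q ^ 2], that is
    [Q > 3]. *)
Lemma egz_theta_lt q : (4 < q)%N -> 1 + egz_theta R q < q%:R.
Proof.
case: q => // Q; rewrite ltnS => Q4; rewrite -natr1 addrC ltrD2r.
have Q4R : 4 <= Q%:R :> R by rewrite ler_nat.
(* The quadratic error is at most [9 e^2 Q^3] and the first-order gain is
   [e Q (Q - 3) / 2 >= e Q / 2], so any [e < 1 / (18 Q^2)] works. *)
pose e : R := (19 * Q%:R ^+ 2)^-1.
have eE : e * (19 * Q%:R ^+ 2) = 1 by rewrite mulVf //; nra.
have e0 : 0 < e by rewrite invr_gt0; nra.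
have e1 : e < 1 by rewrite invf_lt1; nra.
pose s := 1 - e.
have s0 : 0 < s by rewrite /s; lra.
have s1 : s < 1 by rewrite /s; lra.
have rho01 : 0 < s ^+ 3 < 1 by rewrite exprn_gt0 // exprn_ilt1 // ltW.
apply: le_lt_trans (egz_eta_le_rate _ 3 rho01) _.
have -> : rate Q.+1 3 (s ^+ 3) = (\sum_(i < Q) (s ^+ 3) ^+ i) / s ^+ Q.
  rewrite /rate /=; congr (_ * _).
  rewrite -(powR_mulrn 3) ?(ltW s0) // -powRrM -(powR_mulrn Q) ?(ltW s0) // -powRN.
  by congr (_ `^ _); field.
rewrite ltr_pdivrMr ?exprn_gt0 //.
have bern : Q%:R * (1 - Q%:R * e) <= Q%:R * s ^+ Q.
  by rewrite ler_wpM2l // expr_oneB_ge // !ltW.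
have e01 : 0 <= e <= 1 by rewrite !ltW.
have := geometric_sum_cube_le Q e01; rewrite -/s.
set S := \sum_(i < Q) _ => leS; apply: lt_le_trans bern.
have eQ0 : 0 < e * Q%:R by rewrite mulr_gt0 //; lra.
have eQ : e * Q%:R <= e * Q%:R * (Q%:R - 3) by rewrite ler_peMr //; [exact: ltW|lra].
have e2 : 19 * (e ^+ 2 * Q%:R ^+ 3) = e * Q%:R.
  transitivity (e * Q%:R * (e * (19 * Q%:R ^+ 2))); first by ring.
  by rewrite eE mulr1.
lra.
Qed.

End GrowthRate.

(** * From symmetric polynomials to zero sums *)

(** The sets of size [p - 1] are the complements of points. *)
Lemma esym_predE (F : finFieldType) (p : nat) (x : 'I_p -> F) : (0 < p)%N ->
  Defs.esym p.-1 x = \sum_i \prod_(j | j != i) x j.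
Proof.
move=> p0; have cardC1 (i : 'I_p) : #|[set~ i]| = p.-1 by rewrite cardsC1 card_ord.
pose out (I : {set 'I_p}) := odflt (Ordinal p0) [pick i in ~: I].
have outC i : out [set~ i] = i.
  rewrite /out; case: pickP => [j|/(_ i)]; rewrite setCK !inE ?eqxx //.
  by move/eqP.
rewrite /Defs.esym (reindex_onto (fun i => [set~ i]) out) /=.
  apply: eq_big => [i|i _]; first by rewrite outC cardC1 !eqxx.
  by apply: eq_bigl => j; rewrite !inE.
move=> I /eqP cI; have /cards1P[i Ii] : #|~: I| == 1%N.
  by rewrite -(eqn_add2l #|I|) cardsC cI card_ord addn1 prednK.
by rewrite -(setCK I) Ii outC.
Qed.

Lemma esym_pred_invE (F : finFieldType) (p : nat) (x : 'I_p -> F) : (0 < p)%N ->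
  (forall i, x i != 0) -> Defs.esym p.-1 x = \prod_i x i * \sum_i (x i)^-1.
Proof.
move=> p0 x0; rewrite esym_predE // mulr_sumr; apply: eq_bigr => i _.
by rewrite [in RHS](bigD1 i) //= mulrAC mulfV // mul1r.
Qed.

Lemma esym_pred_const (F : finFieldType) (p : nat) (a : F) : p \in [pchar F] ->
  Defs.esym p.-1 (fun _ : 'I_p => a) = 0.
Proof.
move=> pF; rewrite esym_predE ?prime_gt0 ?(pcharf_prime pF) //.
rewrite (eq_bigr (fun=> a ^+ p.-1)) ?sumr_const ?card_ord ?mulrn_pchar // => i _.
rewrite prodr_const; congr (_ ^+ _).
by rewrite -[in RHS](card_ord p) -(cardC1 i).
Qed.

Definition row_support (F : finFieldType) (n : nat) (v : 'rV[F]_n) : {set 'I_n} :=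
  [set j | v ord0 j != 0].

Definition inv_on (F : finFieldType) (n : nat) (W : {set 'I_n}) (v : 'rV[F]_n) :
    'I_#|W| -> F := fun j => (v ord0 (enum_val j))^-1.

Lemma inv_on_neq0 (F : finFieldType) (n : nat) (v : 'rV[F]_n) (j : 'I_#|row_support v|) :
  inv_on v j != 0.
Proof. by rewrite invr_eq0; have := enum_valP j; rewrite inE. Qed.

Lemma inv_on_inj (F : finFieldType) (n : nat) (v w : 'rV[F]_n) (W : {set 'I_n}) :
  row_support v = W -> row_support w = W ->
  @inv_on F n W v =1 @inv_on F n W w -> v = w.
Proof.
move=> vW wW vw; apply/rowP => j; have [jW|jW] := boolP (j \in W).
  have := vw (enum_rank_in jW j); rewrite /inv_on enum_rankK_in //.
  exact: invr_inj.
move: (jW); rewrite -{1}vW inE negbK => /eqP ->.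
by move: jW; rewrite -wW inE negbK => /eqP ->.
Qed.

(** On [W] the polynomial is a product times the sum of the inverses; off [W]
    each of its monomials is zero, having at least one factor. *)
Lemma esym_vec_same_support (F : finFieldType) (n p : nat) (W : {set 'I_n})
    (x : 'I_p -> 'rV[F]_n) :
    (1 < p)%N -> (forall i, row_support (x i) = W) ->
    zero_sum (fun i => @inv_on F n W (x i)) ->
  esym_vec p.-1 x = 0.
Proof.
move=> p1 xW /forallP zx; apply/rowP => j; rewrite !mxE.
have p0 := ltnW p1; have xj i : (x i ord0 j != 0) = (j \in W) by rewrite -(xW i) inE.
have [jW|jW] := boolP (j \in W).
  rewrite esym_pred_invE // => [|i]; last by rewrite xj.
  have := eqP (zx (enum_rank_in jW j)); rewrite /inv_on enum_rankK_in // => ->.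
  by rewrite mulr0.
rewrite /Defs.esym big1 // => I /eqP cI.
have /card_gt0P[i iI] : (0 < #|I|)%N by rewrite cI -ltnS prednK.
have xi0 : x i ord0 j = 0 by apply/eqP/negPn; rewrite xj.
by rewrite (bigD1 i) //= xi0 mul0r.
Qed.

Lemma sum_over_subsets (n : nat) (f : nat -> nat) :
  (\sum_(W : {set 'I_n}) f #|W| = \sum_(w < n.+1) 'C(n, w) * f w)%N.
Proof.
have cardW (W : {set 'I_n}) : (#|W| < n.+1)%N.
  by rewrite ltnS -[X in (_ <= X)%N]card_ord max_card.
rewrite (partition_big (fun W : {set 'I_n} => Ordinal (cardW W)) xpredT) //=.
apply: eq_bigr => w _; rewrite -[n in 'C(n, _)]card_ord -card_draws -sum_nat_const.
by apply: eq_big => [W|W /eqP <-]; rewrite ?inE.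
Qed.

Lemma card_le_sum_supports (F : finFieldType) (n : nat) (A : {set 'rV[F]_n})
    (f : nat -> nat) :
    (forall W : {set 'I_n}, #|[set v in A | row_support v == W]| <= f #|W|)%N ->
  (#|A| <= \sum_(w < n.+1) 'C(n, w) * f w)%N.
Proof.
move=> Af; rewrite -sum_over_subsets -sum1_card.
rewrite (partition_big (@row_support F n) xpredT) //=; apply: leq_sum => W _.
by apply: leq_trans (Af W); rewrite sum1dep_card cardsE.
Qed.

Section Bounds.
Variables (F : finFieldType) (p n : nat).
Hypotheses (p_prime : prime p) (pF : p \in [pchar F]).
Let Q := #|F|.-1.

Lemma card_le_strongly_esym_free (A : {set 'rV[F]_n}) : strongly_esym_free p p.-1 A ->
  (#|A| <= \sum_(w < n.+1) 'C(n, w) * (p * Mcount Q w ((Q * w) %/ p)))%N.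
Proof.
move=> freeA; apply: (card_le_sum_supports
  (f := fun w => p * Mcount Q w ((Q * w) %/ p))%N) => W.
have := @card_le_zero_sum_const F p 'I_#|W| 'rV[F]_n (@inv_on F n W)
  [set v in A | row_support v == W] p_prime pF.
rewrite card_ord; apply.
  by move=> v; rewrite inE => /andP[_ /eqP <-] j; exact: inv_on_neq0.
move=> x xA zx; apply: freeA => [i|]; first by have := xA i; rewrite inE => /andP[].
apply: (esym_vec_same_support (W := W)) => //; first exact: prime_gt1.
by move=> i; have := xA i; rewrite inE => /andP[_ /eqP].
Qed.

Lemma card_le_distinct_esym_free (A : {set 'rV[F]_n}) : odd p ->
    distinct_esym_free p p.-1 A ->
  (#|A| <= \sum_(w < n.+1) 'C(n, w) *
     \sum_(3 <= r < p.+1) r * stirling2 p r * Mcount Q w ((Q * w) %/ r))%N.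
Proof.
move=> p_odd freeA; apply: (card_le_sum_supports (f := fun w =>
  \sum_(3 <= r < p.+1) r * stirling2 p r * Mcount Q w ((Q * w) %/ r))%N) => W.
rewrite -(sum_partitions_stirling p 3 (fun r => Mcount Q #|W| ((Q * #|W|) %/ r))).
have := @card_le_zero_sum_distinct F p 'I_#|W| 'rV[F]_n (@inv_on F n W)
  [set v in A | row_support v == W] p_prime p_odd pF.
rewrite card_ord; apply.
- by move=> v; rewrite inE => /andP[_ /eqP <-] j; exact: inv_on_neq0.
- by move=> v w; rewrite !inE => /andP[_ /eqP vW] /andP[_ /eqP wW]; exact: inv_on_inj.
move=> x xA zx injx; apply: freeA; exists x; split=> // [i|].
  by have := xA i; rewrite inE => /andP[].
apply: (esym_vec_same_support (W := W)) => //; first exact: prime_gt1.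
by move=> i; have := xA i; rewrite inE => /andP[_ /eqP].
Qed.

(** If no value occurs [p] times, there are more than [N] distinct values, hence
    [p] distinct ones on which the polynomial vanishes; a value occurring [p]
    times gives a constant tuple, on which it vanishes in characteristic [p]. *)
Lemma EGZ_bound_of_distinct_free (N : nat) :
    (forall A : {set 'rV[F]_n}, distinct_esym_free p p.-1 A -> (#|A| <= N)%N) ->
  EGZ_bound F p n p.-1 (p.-1 * N).+1.
Proof.
move=> freeN s s_large.
pose idx v := [set i : 'I_(size s) | s`_i == v].
have [/existsP[v pv]|] := boolP [exists v : 'rV[F]_n, p <= #|idx v|]%N.
  exists (fun i => enum_val (widen_ord pv i)).
    by move=> i j /enum_val_inj /(congr1 val) /= /val_inj.
  apply/rowP => j; rewrite !mxE -[RHS](esym_pred_const (v ord0 j) pF).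
  congr (Defs.esym _ _); apply: funext => i.
  by have := enum_valP (widen_ord pv i); rewrite inE => /eqP ->.
rewrite negb_exists => /forallP few.
pose A := [set v in s].
have : (N < #|A|)%N.
  rewrite -(ltn_pmul2l (_ : 0 < p.-1)%N); last first.
    by rewrite -ltnS prednK ?prime_gt1 ?prime_gt0.
  apply: leq_trans s_large _.
  rewrite -[X in (X <= _)%N]card_ord -[X in (X <= _)%N]sum1_card.
  rewrite (partition_big (fun i : 'I_(size s) => s`_i : 'rV[F]_n) [in A]) /=; last first.
    by move=> i _; rewrite inE mem_nth.
  rewrite mulnC -sum_nat_const; apply: leq_sum => v _.
  by rewrite sum1dep_card -ltnS prednK ?prime_gt0 // ltnNge few.
rewrite ltnNge => /negP nA.
have [x [injx xA ex]] : exists x : 'I_p -> 'rV[F]_n,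
    [/\ injective x, forall i, x i \in A & esym_vec p.-1 x = 0].
  by apply: contrapT => nx; apply/nA/freeN.
have xs i : (index (x i) s < size s)%N by rewrite index_mem; have := xA i; rewrite inE.
exists (fun i => Ordinal (xs i)).
  move=> i j /(congr1 val) /= ij; apply: injx.
  by rewrite -(nth_index 0 (s := s) (x := x i)) ?ij ?nth_index // -index_mem.
rewrite -[RHS]ex; congr (esym_vec _ _); apply: funext => i /=.
by rewrite nth_index // -index_mem.
Qed.

End Bounds.

Lemma is_EGZ_exists (F : finFieldType) (t n m l : nat) : EGZ_bound F t n m l ->
  exists2 l', is_EGZ F t n m l' & (l' <= l)%N.
Proof.
move=> bl; have ex : exists l, `[< EGZ_bound F t n m l >] by exists l; apply/asboolP.
exists (ex_minn ex); case: ex_minnP => l' /asboolP bl' min; last by apply/min/asboolP.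
by split=> // l'' bl''; apply/min/asboolP.
Qed.

Lemma sum_binomial_le (R : numDomainType) (n : nat) (f : nat -> nat) (a B : R) :
    (forall w, (f w)%:R <= B * a ^+ w) ->
  (\sum_(w < n.+1) 'C(n, w) * f w)%N%:R <= B * (1 + a) ^+ n.
Proof.
move=> fB; rewrite exprDn natr_sum mulr_sumr; apply: ler_sum => w _.
by rewrite expr1n mul1r mulrnAr natrM mulr_natl lerMn2r fB orbT.
Qed.

Theorem theorem6p4 (R : realType) (p k q n : nat) (F : finFieldType)
    (p_prime : prime p) (p_odd : odd p) (q_def : q = (p ^ k)%N)
    (q_gt4 : (4 < q)%N) (cardF : #|F| = q) (n_ge1 : (1 <= n)%N) :
  [/\ forall A : {set 'rV[F]_n}, strongly_esym_free p p.-1 A ->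
        let b := (p * \sum_(w < n.+1)
                    'C(n, w) * Mcount q.-1 w ((q.-1 * w) %/ p))%N in
        [/\ (#|A| <= b)%N,
            b%:R <= p%:R * (1 + egz_eta R q p) ^+ n :> R
          & 1 + egz_eta R q p < q%:R],
      forall A : {set 'rV[F]_n}, distinct_esym_free p p.-1 A ->
        let b := (\sum_(w < n.+1) 'C(n, w) *
                    \sum_(3 <= r < p.+1) r * stirling2 p r *
                      Mcount q.-1 w ((q.-1 * w) %/ r))%N in
        [/\ (#|A| <= b)%N,
            b%:R <= (Bsum p)%:R * (1 + egz_theta R q) ^+ n :> R
          & 1 + egz_theta R q < q%:R]
    & exists2 l : nat, is_EGZ F p n p.-1 l &
        l%:R <= p.-1%:R * (Bsum p)%:R * (1 + egz_theta R q) ^+ n + 1 :> R].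
Proof.
have pF : p \in [pchar F] by apply: (@card_finPcharP F p k) => //; rewrite cardF.
have p3 : (2 < p)%N by case: p p_prime p_odd {q_def pF} => [|[|[|p]]].
have p0 := prime_gt0 p_prime.
have theta_lt := @egz_theta_lt R q q_gt4.
have eta_lt : 1 + egz_eta R q p < q%:R.
  by apply: le_lt_trans theta_lt; rewrite lerD2l egz_eta_le_theta.
pose f w := (\sum_(3 <= r < p.+1) r * stirling2 p r *
                      Mcount q.-1 w ((q.-1 * w) %/ r))%N.
have f_le w : (f w)%:R <= (Bsum p)%:R * egz_theta R q ^+ w.
  rewrite /f /Bsum !natr_sum mulr_suml big_nat [leRHS]big_nat.
  apply: ler_sum => r /andP[r3 _]; rewrite natrM ler_wpM2l //.
  apply: le_trans (Mcount_le_egz_eta R q w (isT : (0 < 3)%N)).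
  by rewrite ler_nat Mcount_mono // leq_div2l.
pose b := (\sum_(w < n.+1) 'C(n, w) * f w)%N.
have b_le : b%:R <= (Bsum p)%:R * (1 + egz_theta R q) ^+ n :> R.
  exact: sum_binomial_le.
have A_le (A : {set 'rV[F]_n}) : distinct_esym_free p p.-1 A -> (#|A| <= b)%N.
  by move=> /(card_le_distinct_esym_free p_prime pF p_odd); rewrite cardF.
split=> [A freeA|A freeA|].
- split=> //.
    have := card_le_strongly_esym_free p_prime pF freeA; rewrite cardF.
    by rewrite big_distrr /=; under eq_bigr do rewrite mulnCA.
  rewrite natrM ler_wpM2l // -[leRHS]mul1r.
  apply: (@sum_binomial_le R n (fun w => Mcount q.-1 w ((q.-1 * w) %/ p))) => w.
  by rewrite mul1r Mcount_le_egz_eta.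
- by split=> //; exact: A_le.
have [l egz_l l_le] := is_EGZ_exists (EGZ_bound_of_distinct_free p_prime pF A_le).
exists l => //; apply: le_trans (_ : ((p.-1 * b).+1)%:R <= _).
  by rewrite ler_nat.
by rewrite -natr1 lerD2r natrM -mulrA ler_wpM2l.
Qed.
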